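(* For $n\ge 2$, $a_n(1;2\to 2)=a_n(2;1\to 1)=d_n+d_{n-1}$, where $d_m$ denotes the $m$-th derangement number.
   Context: Standard cycle form of $\sigma\in S_n$: $\sigma$ is written as a product of disjoint cycles (fixed points included as 1-cycles), each cycle written starting with its largest element, and the cycles listed in increasing order of their largest elements. The fundamental bijection $\theta:S_n\to S_n$ sends $\sigma$ to the permutation whose one-line notation is obtained by erasing the parentheses from the standard cycle form of $\sigma$ (e.g. $\sigma=413526987=(3)(5214)(6)(8)(97)$ gives $\theta(\sigma)=352146897$). For $\pi\in S_n$ write $\hat\pi=\theta^{-1}(\pi)$. An arrow pattern $\alpha=(\nu;H)$ of size $k$ consists of a string $\nu=a_1\dots a_m$ of positive integers and a set $H=\{b_i\to c_i:1\le i\le h\}$ of arrows, such that the distinct integers appearing in $\nu$ or $H$ form exactly $[k]=\{1,\dots,k\}$. A permutation $\pi=\pi_1\cdots\pi_n\in S_n$ contains $\alpha$ if there is a set $X=\{x_1<\dots<x_k\}\subseteq[n]$ such that (i) there are positions $t_1<\dots<t_m$ with $\pi_{t_1}\cdots\pi_{t_m}=x_{a_1}\cdots x_{a_m}$, and (ii) $\hat\pi(x_{b_i})=x_{c_i}$ for every $i$; otherwise $\pi$ avoids $\alpha$. $a_n(\nu;H)$ is the number of $\pi\in S_n$ avoiding $(\nu;H)$. The derangement number $d_m$ is the number of fixed-point-free permutations of $[m]$ ($d_0=1$). *)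

(* Defs.v *)
From mathcomp Require Import all_boot fingroup perm.

Set Implicit Arguments.
Unset Strict Implicit.
Unset Printing Implicit Defensive.

(* Throughout, [n] = {1, ..., n} is represented by 'I_n = {0, ..., n.-1}: both
   the values of permutations and the letters of patterns are shifted down by
   one. *)

Section FundamentalBijection.
Variable n : nat.
Implicit Types (s p : 'S_n) (i j : 'I_n).

Definition cycle_max s : pred 'I_n :=
  fun i => [forall j, (j \in fingraph.orbit s i) ==> (j <= i)].

(* fingraph.orbit s i is the sequence [:: i; s i; s (s i); ...], and enum 'I_n
   is increasing. *)
Definition std_cycle_form s : seq (seq 'I_n) :=
  [seq fingraph.orbit s i | i <- enum 'I_n & cycle_max s i].

Definition theta_word s : seq 'I_n := flatten (std_cycle_form s).

Definition one_line p : seq 'I_n := [seq p i | i <- enum 'I_n].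

Lemma cycle_maxP s i :
  reflect (forall j, j \in fingraph.orbit s i -> j <= i) (cycle_max s i).
Proof.
apply: (iffP forallP) => H j; first by have/implyP := H j.
by apply/implyP; exact: H.
Qed.

Lemma mem_std_cycle s i :
  exists2 m, fingraph.orbit s m \in std_cycle_form s & i \in fingraph.orbit s m.
Proof.
have ii : i \in fingraph.orbit s i by rewrite -fconnect_orbit connect0.
case: (@arg_maxnP _ i (fun j => j \in fingraph.orbit s i) val ii) => m mi Hm.
have sym := fconnect_sym (@perm_inj _ s).
exists m; last by rewrite -fconnect_orbit sym fconnect_orbit.
apply/mapP; exists m => //; rewrite mem_filter mem_enum andbT.
apply/cycle_maxP => j; rewrite -fconnect_orbit => mj; apply: Hm.
by rewrite -fconnect_orbit; apply: connect_trans mj; rewrite fconnect_orbit.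
Qed.

Lemma mem_theta_word s i : i \in theta_word s.
Proof.
by have [m cm im] := mem_std_cycle s i; apply/flattenP; exists (fingraph.orbit s m).
Qed.

Lemma theta_word_uniq s : uniq (theta_word s).
Proof.
have sym := fconnect_sym (@perm_inj _ s).
rewrite /theta_word /std_cycle_form.
have : uniq [seq i <- enum 'I_n | cycle_max s i] by rewrite filter_uniq ?enum_uniq.
have : all (cycle_max s) [seq i <- enum 'I_n | cycle_max s i] by apply: filter_all.
elim: [seq i <- _ | _] => //= i r IH /andP[mi mr] /andP[ir ur].
rewrite cat_uniq orbit_uniq IH // andbT; apply/hasPn => j /flatten_mapP[m mr' jm].
apply/negP => ji; have mm := allP mr _ mr'.
have im : fconnect s i m.
  by apply: (@connect_trans _ _ j); [|rewrite sym]; rewrite fconnect_orbit.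
suff E : i = m by rewrite E mr' in ir.
apply/val_inj/anti_leq/andP; split.
  by apply: (cycle_maxP _ _ mm); rewrite -fconnect_orbit sym.
by apply: (cycle_maxP _ _ mi); rewrite -fconnect_orbit.
Qed.

Lemma size_theta_word s : size (theta_word s) = n.
Proof.
rewrite -[RHS]card_ord -(card_uniqP (theta_word_uniq s)).
by apply: eq_card => i; rewrite mem_theta_word.
Qed.

Lemma theta_fun_inj s : injective (fun i : 'I_n => nth i (theta_word s) i).
Proof.
move=> i j /eqP; rewrite (set_nth_default i j) ?size_theta_word //.
by rewrite nth_uniq ?size_theta_word ?theta_word_uniq // => /eqP/val_inj.
Qed.

(* The default value i of nth is never used, by size_theta_word. *)
Definition theta s : 'S_n := perm (@theta_fun_inj s).

Lemma one_line_theta s : one_line (theta s) = theta_word s.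
Proof.
case: (posnP n) => [n0|n_gt0].
  have := size_theta_word s; rewrite {2}n0 => /size0nil ->.
  by apply: size0nil; rewrite size_map size_enum_ord.
pose i0 := Ordinal n_gt0.
apply: (@eq_from_nth _ i0); rewrite size_map size_enum_ord ?size_theta_word //.
move=> k kn; rewrite (nth_map i0) ?size_enum_ord // permE.
by rewrite nth_enum_ord //; apply: set_nth_default; rewrite size_theta_word.
Qed.

Lemma flatten_lead_inj (xs ys : seq ('I_n * seq 'I_n)) :
    all (fun x : 'I_n * seq 'I_n => all (fun j : 'I_n => j < x.1) x.2) xs ->
    all (fun x : 'I_n * seq 'I_n => all (fun j : 'I_n => j < x.1) x.2) ys ->
    pairwise (fun x y : 'I_n * seq 'I_n => x.1 < y.1) xs -> pairwise (fun x y : 'I_n * seq 'I_n => x.1 < y.1) ys ->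
    flatten [seq x.1 :: x.2 | x <- xs] = flatten [seq x.1 :: x.2 | x <- ys] ->
  xs = ys.
Proof.
elim: xs ys => [|[m t] xs IH] [|[m' t'] ys] //=.
move=> /andP[tm xsm] /andP[tm' ysm] /andP[mxs pxs] /andP[mys pys] [E].
case: m' / E tm' mys => tm' mys E.
have notin (zs : seq ('I_n * seq 'I_n)) k (u v w : seq 'I_n) :
    all (fun x : 'I_n * seq 'I_n => m < x.1) zs ->
    k :: u ++ v = flatten [seq x.1 :: x.2 | x <- zs] -> m < k.
  by case: zs => [|z zs] //= /andP[mz _] [->].
have Et : t = t'.
  elim: t t' tm tm' E => [|a t IHt] [|b t'] //=.
  - by move=> _ /andP[bm _] /esym/(notin _ _ _ _ [::] mxs); rewrite ltnNge (ltnW bm).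
  - by move=> /andP[am _] _ /(notin _ _ _ _ [::] mys); rewrite ltnNge (ltnW am).
  by move=> /andP[_ tm] /andP[_ tm'] [-> /(IHt _ tm tm') ->].
move: E; rewrite -Et => /eqP; rewrite eqseq_cat // eqxx => /eqP E.
by rewrite (IH ys).
Qed.

Lemma theta_word_inj s s' : theta_word s = theta_word s' ->
  std_cycle_form s = std_cycle_form s'.
Proof.
pose lead s := [seq (i, behead (fingraph.orbit s i)) | i <- enum 'I_n & cycle_max s i].
have orbitE (u : 'S_n) i : fingraph.orbit u i = i :: behead (fingraph.orbit u i).
  by rewrite /fingraph.orbit -orderSpred.
have leadE u : std_cycle_form u = [seq x.1 :: x.2 | x <- lead u].
  by rewrite -map_comp; apply: eq_map => i /=; rewrite -orbitE.
have lead1 u : all (fun x : 'I_n * seq 'I_n => all (fun j : 'I_n => j < x.1) x.2) (lead u).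
  apply/allP => _ /mapP[i + ->] /=; rewrite mem_filter => /andP[/cycle_maxP mi _].
  apply/allP => j ji; rewrite ltn_neqAle mi ?andbT; last first.
    by rewrite orbitE inE ji orbT.
  apply/eqP => /val_inj E; have := orbit_uniq u i.
  by rewrite orbitE cons_uniq -{1}E ji.
have lead2 u : pairwise (fun x y : 'I_n * seq 'I_n => x.1 < y.1) (lead u).
  rewrite pairwise_map /=; apply: (subseq_pairwise (filter_subseq _ _)).
  have := iota_ltn_sorted 0 n; rewrite -val_enum_ord sorted_map.
  by rewrite sorted_pairwise //; move=> ? ? ? /=; apply: ltn_trans.
rewrite /theta_word !leadE => E.
by congr map; apply: flatten_lead_inj.
Qed.

Lemma theta_inj : injective theta.
Proof.
move=> s s' E; have : theta_word s = theta_word s' by rewrite -!one_line_theta E.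
move=> /theta_word_inj Ec; apply/permP => i.
have [m cm im] := mem_std_cycle s i.
have : fingraph.orbit s m \in std_cycle_form s' by rewrite -Ec.
case/mapP => m' _ Em.
have /(next_cycle)/(_ im)/eqP -> := cycle_orbit (@perm_inj _ s) m.
move: im; rewrite Em => im.
by have /(next_cycle)/(_ im)/eqP -> := cycle_orbit (@perm_inj _ s') m'.
Qed.

Definition hat : 'S_n -> 'S_n := invF theta_inj.

End FundamentalBijection.

(* An arrow pattern (nu; H) of size k, with the arrow b -> c encoded as (b, c);
   the last field says that every letter of [k] appears in nu or H. *)
Record arrow_pattern k := ArrowPattern {
  apat_word : seq 'I_k;
  apat_arrows : {set 'I_k * 'I_k};
  apat_surj : forall a : 'I_k, (a \in apat_word) ||
    [exists b, ((a, b) \in apat_arrows) || ((b, a) \in apat_arrows)]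
}.

(* The set X = {x_1 < ... < x_k} is given by its increasing enumeration x. *)
Definition contains n k (p : 'S_n) (alpha : arrow_pattern k) : bool :=
  [exists x : {ffun 'I_k -> 'I_n},
    [&& [forall a : 'I_k, forall b : 'I_k, (a < b) ==> (x a < x b)],
        subseq [seq x a | a <- apat_word alpha] (one_line p)
      & [forall b : 'I_k, forall c : 'I_k,
          ((b, c) \in apat_arrows alpha) ==> (hat p (x b) == x c)]]].

Definition num_avoiders n k (alpha : arrow_pattern k) : nat :=
  #|[set p : 'S_n | ~~ contains p alpha]|.

Definition derangement m : nat :=
  #|[set s : 'S_m | [forall i, s i != i]]|.

Lemma apat_1_22_surj (a : 'I_2) : (a \in [:: ord0 : 'I_2]) ||
  [exists b, ((a, b) \in [set (ord_max : 'I_2, ord_max : 'I_2)])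
             || ((b, a) \in [set (ord_max : 'I_2, ord_max : 'I_2)])].
Proof.
case: a => [[|[|//]] lt]; first by rewrite inE.
by apply/orP; right; apply/existsP; exists ord_max; rewrite !inE !xpair_eqE eqxx andbT.
Qed.

Lemma apat_2_11_surj (a : 'I_2) : (a \in [:: ord_max : 'I_2]) ||
  [exists b, ((a, b) \in [set (ord0 : 'I_2, ord0 : 'I_2)])
             || ((b, a) \in [set (ord0 : 'I_2, ord0 : 'I_2)])].
Proof.
case: a => [[|[|//]] lt]; last by rewrite inE.
by apply/orP; right; apply/existsP; exists ord0; rewrite !inE !xpair_eqE eqxx andbT.
Qed.

(* (1; 2 -> 2) *)
Definition apat_1_22 : arrow_pattern 2 := ArrowPattern apat_1_22_surj.

(* (2; 1 -> 1) *)
Definition apat_2_11 : arrow_pattern 2 := ArrowPattern apat_2_11_surj.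

(* Main.v *)
Require Import Defs.
From mathcomp Require Import all_boot fingroup perm.

(** Every value occurs in the one-line notation of [p], so [p] contains
    (1; 2 -> 2) iff [hat p] has a fixed point other than the least element, and
    (2; 1 -> 1) iff it has one other than the greatest. As [hat] is a bijection,
    both counts are the number of permutations whose only possible fixed point
    is a given [a]: derangements when [a] is moved, and derangements of the
    other points when [a] is fixed. *)

(** Being injective, [s] maps the complement of [a] into itself; [lift a] identifies this complement
    with ['I_n], and [t] is [s] read there. *)
Lemma lift_perm_onto n (a : 'I_n.+1) (s : 'S_n.+1) :
  s a = a -> exists t : 'S_n, s = lift_perm a a t.
Proof.
move=> sa.
have sl j : exists k, s (lift a j) = lift a k.
  have : a != s (lift a j) by rewrite -{1}sa (inj_eq perm_inj) neq_lift.
  by case/unlift_some => k -> _; exists k.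
pose f j := odflt j (unlift a (s (lift a j))).
have fE j : lift a (f j) = s (lift a j).
  by have [k sk] := sl j; rewrite /f sk liftK.
have f_inj : injective f.
  by move=> i j /(congr1 (lift a)); rewrite !fE => /perm_inj/lift_inj.
exists (perm f_inj); apply/permP => i.
case: (unliftP a i) => [j|] ->; last by rewrite lift_perm_id.
by rewrite lift_perm_lift permE fE.
Qed.

Lemma card_fixed_only n (a : 'I_n.+1) :
  #|[set s : 'S_n.+1 | [forall i, (i != a) ==> (s i != i)]]|
  = derangement n.+1 + derangement n.
Proof.
(* Split on whether [s] fixes [a]; [addnC] puts the permutations moving [a], which are the
   derangements, first. *)
rewrite -(cardsID [set s : 'S_n.+1 | s a == a]) addnC; congr (_ + _).
  apply: eq_card => s; rewrite !inE.
  apply/andP/forallP => [[sa /forallP H] i|H].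
    by have := H i; case: eqVneq => [->|].
  by split; [apply: H | apply/forallP => i; rewrite H implybT].
have lift_inj_perm : injective (@lift_perm n a a).
  move=> s t E; apply/permP => i; apply: (@lift_inj _ a).
  by rewrite -!(lift_perm_lift a a) E.
(* The permutations whose only fixed point is [a] are the images of the derangements of ['I_n] under
   [lift_perm a a]. *)
rewrite /derangement -(card_imset _ lift_inj_perm); apply: eq_card => s.
rewrite !inE; apply/andP/imsetP => [[/forallP H /eqP sa]|[t + ->]].
  have [t st] := lift_perm_onto _ _ _ sa; exists t => //.
  rewrite inE; apply/forallP => j; have := H (lift a j).
  by rewrite eq_sym neq_lift st lift_perm_lift (inj_eq lift_inj).
rewrite inE => /forallP H; rewrite lift_perm_id eqxx; split=> //.
apply/forallP => i; case: (unliftP a i) => [j|] ->; last by rewrite eqxx.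
by rewrite lift_perm_lift (inj_eq lift_inj) H implybT.
Qed.

Lemma mem_one_line n (p : 'S_n) i : i \in one_line p.
Proof. by apply/mapP; exists (p^-1%g i); rewrite ?mem_enum ?permKV. Qed.

Lemma hat_inj n : injective (@hat n).
Proof. exact: can_inj (f_invF (@theta_inj n)). Qed.

(** This treats both patterns at once: a one-letter word imposes no condition, which leaves only the
    order of the two values and the loop. *)
Lemma contains_letter_loop n (p : 'S_n) (alpha : arrow_pattern 2) (a b : 'I_2) :
    apat_word alpha = [:: a] -> apat_arrows alpha = [set (b, b)] ->
  reflect (exists2 x : 'I_2 -> 'I_n,
             x ord0 < x ord_max & hat p (x b) = x b)
          (contains p alpha).
Proof.
move=> wE hE; apply: (iffP existsP) => [[x /and3P[/forallP lt _ /forallP H]]|].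
  exists x; first by have /forallP/(_ ord_max) := lt ord0.
  by have /forallP/(_ b) := H b; rewrite hE set11 => /eqP.
case=> x lt fx; exists [ffun a => x a]; apply/and3P; split.
- apply/forallP => c; apply/forallP => d; apply/implyP; rewrite !ffunE.
  (* The only increasing pair in ['I_2] is [ord0], [ord_max], up to the proofs carried by the
     ordinals. *)
  case: c d => [[|[|//]] c] [[|[|//]] d] //= _.
  by congr (x _ < x _): lt; apply: val_inj.
- by rewrite wE /= sub1seq mem_one_line.
apply/forallP => c; apply/forallP => d; apply/implyP.
by rewrite hE inE => /eqP[-> ->]; rewrite !ffunE fx.
Qed.

Lemma num_avoiders_fixed_only n (alpha : arrow_pattern 2) (e : 'I_n.+1) :
    (forall p : 'S_n.+1,
       reflect (exists2 i, i != e & hat p i = i) (contains p alpha)) ->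
  num_avoiders n.+1 alpha = derangement n.+1 + derangement n.
Proof.
move=> containsP; rewrite -(card_fixed_only _ e) -(card_preimset _ (hat_inj _)).
apply: eq_card => p; rewrite !inE; apply/negP/forallP => [H i|H /containsP[i ie fi]].
  by apply/implyP => ie; apply/eqP => fi; case: H; apply/containsP; exists i.
by have := H i; rewrite ie fi eqxx.
Qed.

Theorem theorem2p2 (n : nat) (hn : 2 <= n) :
  num_avoiders n apat_1_22 = derangement n + derangement n.-1 /\
  num_avoiders n apat_2_11 = derangement n + derangement n.-1.
Proof.
case: n hn => // n _; split.
- apply: (num_avoiders_fixed_only _ _ ord0) => p.
  apply: (iffP (contains_letter_loop _ p apat_1_22 _ _ erefl erefl)) => [[x lt fx]|[i i0 fi]].
    by exists (x ord_max) => //; rewrite -val_eqE -lt0n; apply: leq_trans lt.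
  (* The least element lies below any other fixed point, so it can play the letter 1. *)
  exists (fun b => if b == ord0 then ord0 else i) => //=.
  by rewrite lt0n.
- apply: (num_avoiders_fixed_only _ _ ord_max) => p.
  apply: (iffP (contains_letter_loop _ p apat_2_11 _ _ erefl erefl)) => [[x lt fx]|[i im fi]].
    exists (x ord0) => //; rewrite -val_eqE neq_ltn /=.
    by rewrite (leq_trans lt) // -ltnS.
  (* Dually, the greatest element plays the letter 2. *)
  exists (fun b => if b == ord0 then i else ord_max) => //=.
  by rewrite ltn_neqAle -val_eqE in im *; rewrite im -ltnS ltn_ord.
Qed.
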